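(* Let $F$ be an algebraically closed field of characteristic $0$, let $n\ge2$, and let $\mathfrak{A}$ be the (unital) universal associative envelope of the anti-Jordan triple system of all $n\times n$ matrices over $F$, with generators $e_{i,j}$ ($1\le i,j\le n$). The center $Z(\mathfrak{A})=\{z\in\mathfrak{A}\mid zu=uz\text{ for all }u\in\mathfrak{A}\}$ has dimension $5$ over $F$, with basis $$z_1=\tfrac{n-2}{n}e_{1,1}^2-\tfrac2n\sum_{i=2}^ne_{1,i}e_{i,1}+e_{1,1}^4,\qquad z_2=(2-n)e_{1,1}^2+\sum_{i=2}^ne_{1,i}e_{i,1}+\sum_{i=2}^ne_{i,1}e_{1,i},$$ $$z_3=-\tfrac12e_{1,1}+\tfrac12e_{1,1}^3+\sum_{i=2}^ne_{1,i}e_{1,1}e_{i,1},\qquad z_4=\sum_{i=1}^ne_{i,i},\qquad z_5=1.$$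
   Context: The anti-Jordan triple system of all $n\times n$ matrices over $F$ has trilinear product $\langle a,b,c\rangle=abc-cba$. With $\Omega=\{1,\dots,n\}$, its universal associative envelope is $\mathfrak{A}=F\langle X\rangle/I$, where $F\langle X\rangle$ is the free unital associative algebra on symbols $X=\{e_{i,j}\}_{i,j\in\Omega}$ (with $e_{i,j}$ corresponding to the matrix unit $E_{i,j}$), and $I$ is the two-sided ideal generated by all elements $e_{i,j}e_{k,\ell}e_{m,t}-e_{m,t}e_{k,\ell}e_{i,j}-\delta_{j,k}\delta_{\ell,m}e_{i,t}+\delta_{t,k}\delta_{\ell,i}e_{m,j}$ for $i,j,k,\ell,m,t\in\Omega$. The image of $e_{i,j}$ in $\mathfrak{A}$ is again denoted $e_{i,j}$. *)

(* Defs.v *)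
From HB Require Import structures.
From mathcomp Require Import all_boot all_algebra generic_quotient ring_quotient.
From mathcomp Require Import boolp.
From mathcomp Require Import finmap monalg.

Set Implicit Arguments.
Unset Strict Implicit.
Unset Printing Implicit Defensive.

Import GRing.Theory.
Local Open Scope ring_scope.
Local Open Scope quotient_scope.

Definition triple_mx (R : pzRingType) n (a b c : 'M[R]_n) : 'M[R]_n :=
  a *m b *m c - c *m b *m a.

Lemma triple_delta (R : nzRingType) n (i j k l m t : 'I_n) :
  triple_mx (delta_mx i j) (delta_mx k l) (delta_mx m t) =
  ((j == k)%:R * (l == m)%:R) *: (delta_mx i t : 'M[R]_n)
  - ((t == k)%:R * (l == i)%:R) *: (delta_mx m j : 'M[R]_n).
Proof.
rewrite /triple_mx !mul_delta_mx_cond -!scaler_nat -!scalemxAl.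
by rewrite !mul_delta_mx_cond -!scaler_nat !scalerA.
Qed.

Inductive ideal_gen (R : pzRingType) (S : R -> Prop) : R -> Prop :=
| ideal_gen_mem s : S s -> ideal_gen S s
| ideal_gen0 : ideal_gen S 0
| ideal_genD x y : ideal_gen S x -> ideal_gen S y -> ideal_gen S (x + y)
| ideal_genM a x b : ideal_gen S x -> ideal_gen S (a * x * b).

Section Envelope.

Variables (F : fieldType) (n : nat).

(* Finitely supported functions from words over the pairs (i, j) to F, with
   the convolution product: the free unital associative algebra. *)
Definition free_alg : Type := {malg F[{fmonom ('I_n * 'I_n)%type}]}.
HB.instance Definition _ := GRing.Lalgebra.on free_alg.

Definition gen (i j : 'I_n) : free_alg := << fmu (i, j) >>.

(* The linear part is minus the expansion of triple_mx on matrix units given by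
   triple_delta, with delta_mx i j replaced by gen i j. *)
Definition relator (i j k l m t : 'I_n) : free_alg :=
  gen i j * gen k l * gen m t - gen m t * gen k l * gen i j
  - ((j == k)%:R * (l == m)%:R) *: gen i t
  + ((t == k)%:R * (l == i)%:R) *: gen m j.

Definition is_relator (x : free_alg) : Prop :=
  exists i j k l m t : 'I_n, x = relator i j k l m t.

Definition env_ideal : pred free_alg := fun x => `[< ideal_gen is_relator x >].

Lemma env_idealP (x : free_alg) :
  reflect (ideal_gen is_relator x) (x \in env_ideal).
Proof. exact: asboolP. Qed.

Lemma env_ideal_zmod_closed : zmod_closed env_ideal.
Proof.
split=> [|x y /env_idealP hx /env_idealP hy]; apply/env_idealP.
  exact: ideal_gen0.
by apply: ideal_genD => //; rewrite -mulN1r -[_ * _]mulr1; apply: ideal_genM.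
Qed.

HB.instance Definition _ :=
  GRing.isZmodClosed.Build free_alg env_ideal env_ideal_zmod_closed.

Lemma env_idealMl (a x : free_alg) : x \in env_ideal -> a * x \in env_ideal.
Proof.
by move=> /env_idealP hx; apply/env_idealP; rewrite -[_ * _]mulr1;
   apply: ideal_genM.
Qed.

Lemma env_idealMr (x b : free_alg) : x \in env_ideal -> x * b \in env_ideal.
Proof.
by move=> /env_idealP hx; apply/env_idealP; rewrite -[x]mul1r;
   apply: ideal_genM.
Qed.

Lemma free_scale_mul (c : F) (x : free_alg) : c *: x = c%:MP * x.
Proof. by rewrite mul_malgC. Qed.

Lemma free_scalerAr (c : F) (x y : free_alg) : c *: (x * y) = x * (c *: y).
Proof.
apply/malgP => k; rewrite mcoeffZ.
rewrite (mcoeffMlw _ (fsubset_refl _) (fsubset_refl _)) mulr_sumr.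
rewrite (mcoeffMlw (d2 := msupp y) _ (fsubset_refl _)) ?msuppZ_le //.
apply: eq_bigr => k1 _; rewrite mulr_sumr; apply: eq_bigr => k2 _.
by rewrite mcoeffZ mulrnAr mulrCA.
Qed.

Lemma env_idealZ (c : F) (x : free_alg) : x \in env_ideal -> c *: x \in env_ideal.
Proof. by move=> hx; rewrite free_scale_mul env_idealMl. Qed.

(* The relators have no constant term, so the ideal is proper. *)
Lemma env_ideal1 : (1 : free_alg) \notin env_ideal.
Proof.
pose aug : free_alg -> F := @mcoeff {fmonom ('I_n * 'I_n)%type} F mone.
have augU i j : aug (gen i j) = 0.
  by rewrite /aug /gen mcoeffU1 -val_eqE /= fmU fm1.
have augD : {morph aug : x y / x + y} by exact: raddfD.
have augM : {morph aug : x y / x * y}.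
  exact: (rmorphM (@mcoeff {fmonom ('I_n * 'I_n)%type} F mone)).
have augZ c x : aug (c *: x) = c * aug x by exact: mcoeffZ.
have aug0 : aug 0 = 0 by exact: raddf0.
have augN : {morph aug : x / - x} by exact: raddfN.
apply/negP => /env_idealP h1.
have: aug 1 = 0.
  elim: h1 => [s [i [j [k [l [m [t ->]]]]]]||x y _ hx _ hy|a x b _ hx] //.
  - by rewrite /relator !(augD, augN, augM, augZ, augU) !mulr0 subrr subr0 addr0.
  - by rewrite augD hx hy addr0.
  - by rewrite !augM hx mulr0 mul0r.
by rewrite /aug mcoeff1 eqxx => /eqP; rewrite oner_eq0.
Qed.

Definition envelope : Type := Quotient.quot (GRing.ZmodClosed.clone free_alg env_ideal _).
HB.instance Definition _ := GRing.Zmodule.on envelope.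

Definition env_pi (x : free_alg) : envelope := \pi_envelope x.

Lemma env_pi_eq (x y : free_alg) :
  env_pi x = env_pi y <-> ideal_gen is_relator (x - y).
Proof.
rewrite /env_pi; split=> [h|h].
  by apply/env_idealP; rewrite Quotient.idealrBE; apply/eqP.
by apply/eqP; rewrite -Quotient.idealrBE; apply/env_idealP.
Qed.

Lemma env_reprK (x : envelope) : env_pi (repr x) = x.
Proof. exact: reprK. Qed.

Lemma env_pi_eqP (x y : free_alg) :
  x - y \in env_ideal -> env_pi x = env_pi y.
Proof. by move=> /env_idealP/env_pi_eq. Qed.

Lemma repr_env_pi (x : free_alg) : repr (env_pi x) - x \in env_ideal.
Proof. by apply/env_idealP/env_pi_eq; rewrite env_reprK. Qed.

Lemma env_piD : {morph env_pi : x y / x + y}.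
Proof. exact: (raddfD \pi_envelope). Qed.

Definition env_one : envelope := env_pi 1.
Definition env_mul (x y : envelope) : envelope := env_pi (repr x * repr y).
Definition env_scale (c : F) (x : envelope) : envelope := env_pi (c *: repr x).

Lemma env_pi_mul (x y : free_alg) : env_mul (env_pi x) (env_pi y) = env_pi (x * y).
Proof.
apply: env_pi_eqP.
have -> : repr (env_pi x) * repr (env_pi y) - x * y =
  (repr (env_pi x) - x) * repr (env_pi y) + x * (repr (env_pi y) - y).
  by rewrite mulrBl mulrBr addrA subrK.
by apply: rpredD; [apply: env_idealMr|apply: env_idealMl]; apply: repr_env_pi.
Qed.

Lemma env_pi_scale (c : F) (x : free_alg) :
  env_scale c (env_pi x) = env_pi (c *: x).
Proof. by apply: env_pi_eqP; rewrite -scalerBr env_idealZ ?repr_env_pi. Qed.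

Lemma env_mulA : associative env_mul.
Proof.
move=> x y z; rewrite -[x]env_reprK -[y]env_reprK -[z]env_reprK.
by rewrite !env_pi_mul mulrA.
Qed.

Lemma env_mul1 : left_id env_one env_mul.
Proof. by move=> x; rewrite -[x]env_reprK env_pi_mul mul1r. Qed.

Lemma env_mulr1 : right_id env_one env_mul.
Proof. by move=> x; rewrite -[x]env_reprK env_pi_mul mulr1. Qed.

Lemma env_mulDl : left_distributive env_mul +%R.
Proof.
move=> x y z; rewrite -[x]env_reprK -[y]env_reprK -[z]env_reprK.
by rewrite -(env_piD (repr x)) !env_pi_mul -env_piD mulrDl.
Qed.

Lemma env_mulDr : right_distributive env_mul +%R.
Proof.
move=> x y z; rewrite -[x]env_reprK -[y]env_reprK -[z]env_reprK.
by rewrite -(env_piD (repr y)) !env_pi_mul -env_piD mulrDr.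
Qed.

Lemma env_one_neq0 : env_one != 0.
Proof.
apply/eqP => h; have : env_pi 1 = env_pi 0 by rewrite [LHS]h /env_pi raddf0.
by move=> /env_pi_eq; rewrite subr0 => /env_idealP; rewrite (negPf env_ideal1).
Qed.

HB.instance Definition _ := GRing.Zmodule_isNzRing.Build envelope
  env_mulA env_mul1 env_mulr1 env_mulDl env_mulDr env_one_neq0.

Lemma env_scaleA (c d : F) (x : envelope) :
  env_scale c (env_scale d x) = env_scale (c * d) x.
Proof. by rewrite -[x]env_reprK !env_pi_scale scalerA. Qed.

Lemma env_scale1 : left_id 1 env_scale.
Proof. by move=> x; rewrite -[x]env_reprK env_pi_scale scale1r. Qed.

Lemma env_scaleDr : right_distributive env_scale +%R.
Proof.
move=> c x y; rewrite -[x]env_reprK -[y]env_reprK -env_piD !env_pi_scale.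
by rewrite -env_piD scalerDr.
Qed.

Lemma env_scaleDl (x : envelope) : {morph env_scale^~ x : c d / c + d}.
Proof.
by move=> c d; rewrite -[x]env_reprK !env_pi_scale -env_piD scalerDl.
Qed.

HB.instance Definition _ := GRing.Zmodule_isLmodule.Build F envelope
  env_scaleA env_scale1 env_scaleDr env_scaleDl.

Lemma env_scalerAl (c : F) (x y : envelope) :
  env_scale c (env_mul x y) = env_mul (env_scale c x) y.
Proof.
rewrite -[x]env_reprK -[y]env_reprK env_pi_mul (env_pi_scale c (repr x)).
by rewrite env_pi_mul (env_pi_scale c (_ * _)) scalerAl.
Qed.

HB.instance Definition _ :=
  GRing.Lmodule_isLalgebra.Build F envelope env_scalerAl.

Lemma env_scalerAr (c : F) (x y : envelope) :
  env_scale c (env_mul x y) = env_mul x (env_scale c y).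
Proof.
rewrite -[x]env_reprK -[y]env_reprK env_pi_mul (env_pi_scale c (repr y)).
by rewrite env_pi_mul (env_pi_scale c (_ * _)) free_scalerAr.
Qed.

HB.instance Definition _ :=
  GRing.Lalgebra_isAlgebra.Build F envelope env_scalerAr.

Definition env_gen (i j : 'I_n) : envelope := env_pi (gen i j).

End Envelope.

Arguments env_gen {F n} i j.

Definition ring_center (A : pzRingType) : A -> Prop :=
  fun z => forall u : A, z * u = u * z.

Definition is_basis (F : fieldType) (V : lmodType F) d (b : d.-tuple V)
    (U : V -> Prop) : Prop :=
  [/\ forall i : 'I_d, U (tnth b i),
      forall c : 'I_d -> F,
        \sum_(i < d) c i *: tnth b i = 0 -> forall i : 'I_d, c i = 0
    & forall v : V, U v ->
        exists c : 'I_d -> F, v = \sum_(i < d) c i *: tnth b i].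

Definition has_dimension (F : fieldType) (V : lmodType F) (U : V -> Prop)
    (d : nat) : Prop :=
  exists b : d.-tuple V, is_basis b U.

(* Ordinals count from 0: the matrix index 1 is the ordinal o of value 0, and
   a sum over i = 2, ..., n runs over the ordinals i with 0 < i. *)
Section CentralElements.

Variables (F : fieldType) (n : nat) (n_ge2 : (2 <= n)%N).

Let o : 'I_n := Ordinal (ltnW n_ge2).
Let e (i j : 'I_n) : envelope F n := env_gen i j.

Definition center_z1 : envelope F n :=
  ((n%:R - 2) / n%:R) *: e o o ^+ 2
  - (2 / n%:R) *: (\sum_(i < n | (0 < i)%N) e o i * e i o)
  + e o o ^+ 4.

Definition center_z2 : envelope F n :=
  (2 - n%:R) *: e o o ^+ 2
  + \sum_(i < n | (0 < i)%N) e o i * e i o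
  + \sum_(i < n | (0 < i)%N) e i o * e o i.

Definition center_z3 : envelope F n :=
  - (2^-1 *: e o o) + 2^-1 *: e o o ^+ 3
  + \sum_(i < n | (0 < i)%N) e o i * e o o * e i o.

Definition center_z4 : envelope F n := \sum_(i < n) e i i.

Definition center_z5 : envelope F n := 1.

End CentralElements.

(* Main.v *)
Require Import Defs.
From Stdlib Require Import Ncring Ncring_tac.
From HB Require Import structures.
From mathcomp Require Import all_boot all_algebra generic_quotient ring.
From mathcomp Require Import monalg.
Set Implicit Arguments.
Unset Strict Implicit.
Unset Printing Implicit Defensive.

Import GRing.Theory.
Local Open Scope ring_scope.

(** Let phi : M_n -> A be the linear map with phi(E_ij) = e_ij, so that
    phi(a) phi(b) phi(c) - phi(c) phi(b) phi(a) = phi(abc - cba), and let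
    z = phi(1), which is z_4.  Everything follows from three facts about z:
    it is central, z^4 phi(x) = phi(x), and
      phi(x) phi(y) = (z phi(xy + yx) + z^3 phi(xy - yx)) / 2.
    They are obtained as follows.  A word of length four can be brought from
    abcd to cdab in two ways (exchange the letters 1, 3 and then 2, 4, or the
    reverse); comparing the corrections gives an identity between products of
    two factors (triple_four).  Setting some of its letters to 1 yields the
    centrality of z (phi1_comm) and the Jordan identity
    phi(x) phi(y) + phi(y) phi(x) = z phi(xy + yx) (phi_jordan), while the
    defining relation with middle letter 1 reads
    z (phi(x) phi(y) - phi(y) phi(x)) = phi(xy - yx).  Together they compute
    4 z^2 phi(abc - cba) in terms of phi alone, which forces z^4 - 1 to kill
    phi of every matrix of trace 0, and then z itself (phi_pow4).

    By the product formula, A = F + sum_(k < 4) z^k phi(M_n)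
    (nform_span_phiM, env_ind).  This sum is direct (nform_free): it is
    separated by the five representations phi = 0, x |-> x, x |-> - x and
    x |-> l x^T with l^2 = -1, which are thus the components of
    A = F + M_n^4.  As phi(x) phi(a) - phi(a) phi(x) = z^3 phi(xa - ax),
    directness shows that an element of A is central exactly when its four
    matrix coefficients are scalar, so the center has basis
    1, z, z^2, z^3, z^4 (center_phi1_pol, phi1_pol_inj).  Finally the product
    formula gives z_1 = (z^4 - z^2) / n, z_2 = z^2 and z_3 = (z^3 - z) / 2,
    a triangular change of basis. *)

(** * Identities in noncommutative rings *)

(** These two instances let non_commutative_ring decide polynomial identities
    over any pzRingType. *)
#[local] Instance pzring_ops (A : pzRingType) :
  @Ring_ops A 0 1 +%R *%R (fun x y => x - y) -%R eq := {}.

#[local] Instance pzring_ncring (A : pzRingType) : Ring (Ro := pzring_ops A).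
Proof.
split; try by [move=> *; reflexivity | move=> x y -> // u v ->].
- exact: eq_equivalence.
- exact: add0r.
- exact: addrC.
- exact: addrA.
- exact: mul1r.
- exact: mulr1.
- exact: mulrA.
- exact: mulrDl.
- by move=> x y z; apply: mulrDr.
- exact: subrr.
Qed.

(** * Linear maps on matrices *)

Lemma linear_bundle (F : fieldType) (U V : lmodType F) (f : U -> V) :
  linear f -> {g : {linear U -> V} | g =1 f}.
Proof.
move=> f_lin; pose g : {linear U -> V} :=
  HB.pack f (GRing.isLinear.Build _ _ _ _ f f_lin).
by exists g.
Qed.

Lemma linear_delta_ext (F : fieldType) (n : nat) (V : lmodType F)
    (f g : 'M[F]_n -> V) :
  linear f -> linear g -> (forall i j, f (delta_mx i j) = g (delta_mx i j)) ->
  f =1 g.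
Proof.
move=> /linear_bundle[f' f'E] /linear_bundle[g' g'E] fg x.
rewrite -f'E -g'E [x]matrix_sum_delta !linear_sum.
apply: eq_bigr => i _; rewrite !linear_sum; apply: eq_bigr => j _.
by rewrite !linearZ_LR f'E g'E fg.
Qed.

Section LinearCombination.

Variables (F : fieldType) (n : nat) (A : algType F) (e : 'I_n -> 'I_n -> A).

Definition mx_comb (x : 'M[F]_n) : A := \sum_i \sum_j x i j *: e i j.

Lemma mx_comb_linear : linear mx_comb.
Proof.
move=> c x y; rewrite /mx_comb scaler_sumr -big_split; apply: eq_bigr => i _ /=.
rewrite scaler_sumr -big_split; apply: eq_bigr => j _ /=.
by rewrite !mxE scalerDl scalerA.
Qed.

HB.instance Definition _ :=
  GRing.isLinear.Build F 'M[F]_n A *:%R mx_comb mx_comb_linear.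

Lemma mx_comb_delta i j : mx_comb (delta_mx i j) = e i j.
Proof.
rewrite /mx_comb (bigD1 i) //= (bigD1 j) //= mxE !eqxx scale1r.
rewrite big1 => [|k /negPf ne_kj]; last by rewrite mxE ne_kj andbF scale0r.
rewrite big1 => [|k /negPf ne_ki]; first by rewrite !addr0.
by rewrite big1 // => l _; rewrite mxE ne_ki scale0r.
Qed.

Lemma mx_comb_triple :
  (forall i j k l m t : 'I_n,
    e i j * e k l * e m t - e m t * e k l * e i j
    - ((j == k)%:R * (l == m)%:R) *: e i t
    + ((t == k)%:R * (l == i)%:R) *: e m j = 0) ->
  forall a b c,
    mx_comb a * mx_comb b * mx_comb c - mx_comb c * mx_comb b * mx_comb a =
    mx_comb (a * b * c - c * b * a).
Proof.
move=> e_rel a b c; rewrite -[a * b * c - c * b * a]/(triple_mx a b c).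
move: a; apply: linear_delta_ext => [r x y|r x y|i j].
- by rewrite linearP !(mulrDl, mulrDr) -!(scalerAl, scalerAr) scalerBr opprD
    addrACA.
- rewrite -linearP; congr mx_comb; rewrite /triple_mx.
  by rewrite !(mulmxDl, mulmxDr) -!(scalemxAl, scalemxAr) scalerBr opprD addrACA.
move: b; apply: linear_delta_ext => [r x y|r x y|k l].
- by rewrite linearP !(mulrDl, mulrDr) -!(scalerAl, scalerAr) scalerBr opprD
    addrACA.
- rewrite -linearP; congr mx_comb; rewrite /triple_mx.
  by rewrite !(mulmxDl, mulmxDr) -!(scalemxAl, scalemxAr) scalerBr opprD addrACA.
move: c; apply: linear_delta_ext => [r x y|r x y|m t].
- by rewrite linearP !(mulrDl, mulrDr) -!(scalerAl, scalerAr) scalerBr opprD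
    addrACA.
- rewrite -linearP; congr mx_comb; rewrite /triple_mx.
  by rewrite !(mulmxDl, mulmxDr) -!(scalemxAl, scalemxAr) scalerBr opprD addrACA.
rewrite triple_delta linearB !linearZ /= !mx_comb_delta.
apply: subr0_eq; rewrite -[RHS](e_rel i j k l m t) opprD scalerN opprK.
exact: addrA.
Qed.

End LinearCombination.

(** Modulo commutators every matrix x is congruent to (tr x / n) 1: off-diagonal
    units are commutators, and so are differences of diagonal ones. *)
Lemma linear_commutator_trace (F : fieldType) (V : lmodType F) (n : nat)
    (f : 'M[F]_n -> V) :
  linear f -> (forall a b, f (a * b - b * a) = 0) ->
  forall x, f x *+ n = \tr x *: f 1.
Proof.
move=> /linear_bundle[f' f'E] f_comm.
have f'_comm a b : f' (a *m b - b *m a) = 0 by rewrite f'E; apply: f_comm.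
have f_off i j : i != j -> f' (delta_mx i j) = 0.
  move=> neq_ij; rewrite -(f'_comm (delta_mx i i) (delta_mx i j)).
  by rewrite mul_delta_mx mul_delta_mx_0 1?eq_sym // subr0.
have f_diag i j : f' (delta_mx i i) = f' (delta_mx j j).
  apply/eqP; rewrite -subr_eq0 -linearB.
  by rewrite -(mul_delta_mx j i i) -(mul_delta_mx i j j) f'_comm.
have f1 i : f' (delta_mx i i) *+ n = f' 1%:M.
  rewrite scalar_mx_sum_delta linear_sum -[X in _ *+ X]card_ord -sumr_const.
  by apply: eq_bigr => j _; rewrite scale1r; apply: f_diag.
move=> x; rewrite -!f'E -[1]/(1%:M) /mxtrace scaler_suml.
rewrite {1}[x]matrix_sum_delta linear_sum -sumrMnl; apply: eq_bigr => i _.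
rewrite linear_sum (bigD1 i) //= big1 => [|j ne_ji]; rewrite linearZ_LR.
  by rewrite addr0 scalerMnr f1.
by rewrite f_off 1?eq_sym ?scaler0.
Qed.

Lemma scalar_mx_of_comm (F : fieldType) (n : nat) (x : 'M[F]_n) :
  (0 < n)%N -> (forall a, x * a = a * x) -> exists c, x = c%:M.
Proof.
move=> n_gt0 x_comm; pose o := Ordinal n_gt0; exists (x o o).
apply/matrixP => i j; rewrite mxE.
have := congr1 (fun y : 'M_n => y i o) (x_comm (delta_mx j o)).
rewrite -!mulmxE !mxE (bigD1 j) //= big1 => [|k /negPf ne_kj].
  rewrite (bigD1 o) //= big1 => [|k /negPf ne_ko].
    by rewrite !mxE !eqxx !andbT !mulr1 !addr0 mulr_natl.
  by rewrite !mxE ne_ko andbF mul0r.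
by rewrite !mxE ne_kj mulr0.
Qed.

Lemma scalar_mx_eq0 (F : fieldType) (n : nat) (c : F) :
  (0 < n)%N -> c%:M = 0 :> 'M[F]_n -> c = 0.
Proof.
move=> n_gt0 /matrixP/(_ (Ordinal n_gt0) (Ordinal n_gt0)).
by rewrite !mxE eqxx mulr1n.
Qed.

Section ScaledRepresentations.

Variables (F : fieldType) (n : nat) (s : F) (a b c : 'M[F]_n).

Lemma scale_triple : s ^+ 3 = s ->
  (s *: a) * (s *: b) * (s *: c) - (s *: c) * (s *: b) * (s *: a) =
  s *: (a * b * c - c * b * a).
Proof.
move=> s3; rewrite -!mulmxE -!(scalemxAl, scalemxAr) !scalerA.
by rewrite -[s * (s * s)]/(s ^+ 3) s3 scalerBr.
Qed.

(** Transposition turns abc - cba into its opposite with the factors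
    transposed; the sign is absorbed by s^3 = - s. *)
Lemma scale_tr_triple : s ^+ 3 = - s ->
  (s *: a^T) * (s *: b^T) * (s *: c^T) - (s *: c^T) * (s *: b^T) * (s *: a^T) =
  s *: (a * b * c - c * b * a)^T.
Proof.
move=> s3; rewrite -!mulmxE -!(scalemxAl, scalemxAr) !scalerA.
rewrite -[s * (s * s)]/(s ^+ 3) s3.
by rewrite linearB /= !trmx_mul !mulmxA !scaleNr scalerBr opprK addrC.
Qed.

End ScaledRepresentations.

(** * Bases with five elements *)

(** Names the five coefficients, which is_basis indexes by 'I_5. *)
Lemma is_basis5 (F : fieldType) (V : lmodType F) (b0 b1 b2 b3 b4 : V)
    (U : V -> Prop) :
  [/\ U b0, U b1, U b2, U b3 & U b4] ->
  (forall c0 c1 c2 c3 c4,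
    c0 *: b0 + c1 *: b1 + c2 *: b2 + c3 *: b3 + c4 *: b4 = 0 ->
    [/\ c0 = 0, c1 = 0, c2 = 0, c3 = 0 & c4 = 0]) ->
  (forall v, U v -> exists c0 c1 c2 c3 c4,
    v = c0 *: b0 + c1 *: b1 + c2 *: b2 + c3 *: b3 + c4 *: b4) ->
  is_basis [tuple b0; b1; b2; b3; b4] U.
Proof.
move=> [U0 U1 U2 U3 U4] free_b span_b.
have sumE (c : 'I_5 -> F) :
    \sum_(i < 5) c i *: tnth [tuple b0; b1; b2; b3; b4] i =
    c (inord 0) *: b0 + c (inord 1) *: b1 + c (inord 2) *: b2
    + c (inord 3) *: b3 + c (inord 4) *: b4.
  rewrite !big_ord_recr big_ord0 /= add0r !(tnth_nth 0) /=.
  by do 4?[congr (_ + _)]; congr (c _ *: _); apply/val_inj; rewrite /= inordK.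
split=> [i|c|v /span_b[c0 [c1 [c2 [c3 [c4 ->]]]]]].
- by rewrite (tnth_nth 0); case: i => [[|[|[|[|[|]]]]]].
- rewrite sumE => /free_b[? ? ? ? ?] i; rewrite -[i]inord_val.
  by case: i => [[|[|[|[|[|]]]]]].
- exists (fun i => nth 0 [:: c0; c1; c2; c3; c4] i).
  by rewrite sumE !inordK.
Qed.

(** * Maps satisfying the triple identity *)

Section TripleRepresentation.

Variables (F : fieldType) (charF0 : [pchar F] =i pred0).
Variables (n : nat) (n_ge2 : (2 <= n)%N) (A : algType F).
Variable phi : {linear 'M[F]_n -> A}.

Hypothesis phi_triple : forall a b c,
  phi a * phi b * phi c - phi c * phi b * phi a = phi (a * b * c - c * b * a).

Local Notation z := (phi 1).

Local Ltac ncring :=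
  lazymatch goal with |- @eq _ ?x ?y => change (@eq A x y) end;
  non_commutative_ring.

Let n_gt0 : (0 < n)%N. Proof. exact: ltnW. Qed.

Let natF_neq0 k : (0 < k)%N -> (k%:R : F) != 0.
Proof. by rewrite ((pcharf0P F).1 charF0) -lt0n. Qed.

Let F2 : (2 : F) != 0. Proof. exact: (@natF_neq0 2%N _). Qed.

(** An identity linear in one matrix need only be checked on commutators, where
    the triple identity applies, and on 1. *)
Lemma linear_commutator_eq0 (f : 'M[F]_n -> A) :
  linear f -> (forall a b, f (a * b - b * a) = 0) -> f 1 = 0 -> f =1 fun=> 0.
Proof.
move=> f_lin f_comm f1 x; apply: (scalerI (natF_neq0 n_gt0)).
by rewrite scaler0 scaler_nat (linear_commutator_trace f_lin) // f1 scaler0.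
Qed.

(** Both sides are phi(a) phi(b) phi(c) phi(d) - phi(c) phi(d) phi(a) phi(b),
    computed by exchanging the letters 1, 3 first on the left, and the letters
    2, 4 first on the right. *)
Lemma triple_four a b c d :
  phi c * phi (b * a * d - d * a * b) + phi (a * b * c - c * b * a) * phi d =
  phi (a * d * c - c * d * a) * phi b + phi a * phi (b * c * d - d * c * b).
Proof. by rewrite -!phi_triple; ncring. Qed.

Lemma phi1_comm x : phi x * z = z * phi x.
Proof.
apply/eqP; rewrite -subr_eq0; apply/eqP; move: x.
apply: linear_commutator_eq0 => [c x y|a b|]; last exact: subrr.
  by rewrite linearP mulrDl mulrDr -scalerAl -scalerAr scalerBr opprD addrACA.
have := triple_four a b 1 1.
rewrite !(mulr1, mul1r) !subrr linear0 mul0r mulr0 addr0 => <-.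
by rewrite linearB linearB /=; ncring.
Qed.

Lemma phi1X_comm k x : phi x * z ^+ k = z ^+ k * phi x.
Proof. exact/commrX/phi1_comm. Qed.

Lemma phi_jordan x y :
  phi x * phi y + phi y * phi x = z * (phi (x * y) + phi (y * x)).
Proof.
(* The identity is linear in x, and holds for x = 1 because z is central. *)
apply/eqP; rewrite -subr_eq0; apply/eqP; move: x.
apply: linear_commutator_eq0 => [c x x'|a b|].
- rewrite !(linearP, mulrDl, mulrDr) /= -!scalerAl -!scalerAr.
  rewrite -!mulmxE -!scalemxAl -!scalemxAr.
  rewrite !linearP /= !mulrDr -!scalerAr !scalerBr !scalerDr.
  by ncring.
- (* These two instances have the same right-hand side. *)
  have := triple_four a b y 1; have := triple_four a b 1 y.
  rewrite !(mulr1, mul1r) phi1_comm => <-.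
  rewrite !mulrBl !mulrBr !linearB /= -!mulrA.
  by move/eqP; rewrite eq_sym -subr_eq0 => /eqP <-; ncring.
- by rewrite !(mulr1, mul1r) phi1_comm mulrDr subrr.
Qed.

Lemma phi_commutator x y :
  z * (phi x * phi y - phi y * phi x) = phi (x * y) - phi (y * x).
Proof.
have := phi_triple x 1 y; rewrite !mulr1 linearB => <- /=.
by rewrite mulrBr !mulrA !phi1_comm.
Qed.

Let dbl x y := z * z * (phi (x * y) + phi (y * x)) + (phi (x * y) - phi (y * x)).

Let phi_mul_dbl x y : z * phi x * phi y + z * phi x * phi y = dbl x y.
Proof. by rewrite /dbl -phi_commutator -(mulrA z z) -phi_jordan; ncring. Qed.

(** Reducing phi(a) phi(b) phi(c) - phi(c) phi(b) phi(a), multiplied by 4 z^2,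
    to values of phi by means of dbl gives 4 z^2 phi(abc - cba) minus z^4 - 1
    times phi of the commutator of ac - ca and b. *)
Lemma phi_pow4_comm2 a b c :
  z ^+ 4 * phi ((a * c - c * a) * b - b * (a * c - c * a)) =
    phi ((a * c - c * a) * b - b * (a * c - c * a)).
Proof.
have four x y w : let u := z * z * (phi x * phi y * phi w) in
    u + u + (u + u) =
    z * z * (dbl (x * y) w + dbl (y * x) w) + (dbl (x * y) w - dbl (y * x) w).
  move=> u.
  have -> : u + u + (u + u) =
      z * (z * phi x * phi y + z * phi x * phi y) * phi w +
      z * (z * phi x * phi y + z * phi x * phi y) * phi w.
    by rewrite /u; ncring.
  by rewrite phi_mul_dbl -!(phi_mul_dbl _ w) /dbl; ncring.
have := congr1 (fun v => z * z * (v + v + (v + v))) (phi_triple a b c).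
have -> (p q : A) : z * z * (p - q + (p - q) + (p - q + (p - q))) =
    let u := z * z * p in let v := z * z * q in u + u + (u + u) - (v + v + (v + v)).
  by rewrite /=; ncring.
rewrite /= !four /dbl => E.
rewrite !exprS expr0 mulr1.
apply/eqP; rewrite eq_sym -subr_eq0.
move/eqP: E; rewrite -subr_eq0 => /eqP <-.
rewrite !mulrBl !mulrBr !linearB /= !mulrA.
by apply/eqP; ncring.
Qed.

Lemma phi_pow4 x : z ^+ 4 * phi x = phi x.
Proof.
pose f y := z ^+ 4 * phi y - phi y.
have f_lin : linear f.
  by move=> c x1 x2; rewrite /f linearP mulrDr -scalerAr scalerBr opprD addrACA.
have fB x1 x2 : f (x1 - x2) = f x1 - f x2.
  by rewrite addrC -scaleN1r f_lin scaleN1r addrC.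
have f_comm a b : f (a * b - b * a) = 0.
  (* In a, this holds for commutators and for 1, hence for all matrices. *)
  move: a.
  apply: (linear_commutator_eq0 (f := fun a => f (a * b - b * a))) => [c x1 x2|a c|].
  - rewrite -f_lin; congr f.
    by rewrite mulrDl mulrDr -!mulmxE -scalemxAl -scalemxAr scalerBr opprD addrACA.
  - by rewrite /f phi_pow4_comm2 subrr.
  - by rewrite mul1r mulr1 subrr /f linear0 mulr0 subrr.
suff f1 : f 1 = 0.
  by apply/eqP; rewrite -subr_eq0; apply/eqP; move: x; apply: linear_commutator_eq0.
(* If a is a commutator then z^4 - 1 kills phi(apq - qpa), whatever p and q are.
   For a = pq - qp this is congruent to a^2 modulo commutators; here a is
   diag(1, -1, 0, .., 0), and a^2 has trace 2. *)
pose p : 'M[F]_n := delta_mx (Ordinal n_gt0) (Ordinal n_ge2).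
pose q : 'M[F]_n := delta_mx (Ordinal n_ge2) (Ordinal n_gt0).
pose a := p * q - q * p.
have f_aa : f (a * a) = 0.
  have phi_a : z ^+ 4 * phi a = phi a.
    by apply/eqP; rewrite -subr_eq0 -/(f a) f_comm.
  have: f (a * p * q - q * p * a) = 0.
    rewrite /f -phi_triple mulrBr !(mulrA (z ^+ 4)) phi_a -phi1X_comm.
    rewrite -(mulrA _ (z ^+ 4)) -phi1X_comm (mulrA (phi q)) -(mulrA _ (z ^+ 4)).
    by rewrite phi_a subrr.
  rewrite fB => /eqP; rewrite subr_eq0 => /eqP fapq.
  by rewrite {2}/a mulrBr fB !mulrA fapq -fB -(mulrA a q); apply: f_comm.
have tr_delta i : \tr (delta_mx i i : 'M[F]_n) = 1.
  rewrite /mxtrace (bigD1 i) //= mxE !eqxx big1 ?addr0 // => k /negPf ne_ki.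
  by rewrite mxE ne_ki.
have tr_aa : \tr (a * a) = 2.
  rewrite /a /p /q -!mulmxE mulmxBl !mulmxBr -!mulmxA !mul_delta_mx_cond /=.
  by rewrite !mulr0n !mulr1n !linear0 addr0 sub0r opprK linearD /= !tr_delta.
have := linear_commutator_trace f_lin f_comm (a * a).
rewrite f_aa mul0rn tr_aa => /esym/eqP.
by rewrite scaler_eq0 (negPf F2) => /eqP.
Qed.

Lemma phi_commutator_pow3 x y :
  phi x * phi y - phi y * phi x = z ^+ 3 * (phi (x * y) - phi (y * x)).
Proof.
by rewrite -phi_commutator mulrA -exprSr mulrBr !mulrA !phi_pow4.
Qed.

Lemma phi_mul x y : phi x * phi y = 2^-1 *:
  (z * (phi (x * y) + phi (y * x)) + z ^+ 3 * (phi (x * y) - phi (y * x))).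
Proof.
rewrite -phi_commutator_pow3 -phi_jordan addrACA subrr addr0.
by rewrite -mulr2n -scaler_nat scalerK.
Qed.

(** * The normal form *)

Definition nform c x0 x1 x2 x3 :=
  c%:A + phi x0 + z * phi x1 + z ^+ 2 * phi x2 + z ^+ 3 * phi x3.

Lemma nform_linear k c x0 x1 x2 x3 d y0 y1 y2 y3 :
  k *: nform c x0 x1 x2 x3 + nform d y0 y1 y2 y3 =
  nform (k * c + d) (k *: x0 + y0) (k *: x1 + y1) (k *: x2 + y2) (k *: x3 + y3).
Proof.
rewrite /nform !linearP /= !mulrDr -!scalerAr scalerDl -scalerA !scalerDr.
by do 4![rewrite addrACA; congr (_ + _)].
Qed.

Lemma phi1_nform c x0 x1 x2 x3 :
  z * nform c x0 x1 x2 x3 = nform 0 (c%:M + x3) x0 x1 x2.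
Proof.
rewrite /nform scale0r add0r linearD /= -[phi x3 in RHS]phi_pow4.
rewrite -[c%:M]scalemx1 linearZ !mulrDr -scalerAr mulr1 !exprS expr0 mulr1 !mulrA.
by rewrite -!(addrAC _ (z * z * z * z * phi x3)).
Qed.

Definition nform_span u := exists c x0 x1 x2 x3, u = nform c x0 x1 x2 x3.

Lemma nform_span1 : nform_span 1.
Proof.
by exists 1, 0, 0, 0, 0; rewrite /nform linear0 !mulr0 !addr0 scale1r.
Qed.

Lemma nform_span_phi x : nform_span (phi x).
Proof.
by exists 0, x, 0, 0, 0; rewrite /nform linear0 !mulr0 !addr0 scale0r add0r.
Qed.

Lemma nform_spanP k u v : nform_span u -> nform_span v -> nform_span (k *: u + v).
Proof.
move=> [c [x0 [x1 [x2 [x3 ->]]]]] [d [y0 [y1 [y2 [y3 ->]]]]].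
by rewrite nform_linear; do 5!eexists.
Qed.

Lemma nform_spanD u v : nform_span u -> nform_span v -> nform_span (u + v).
Proof. by rewrite -[u in u + v]scale1r; apply: nform_spanP. Qed.

Lemma nform_spanZ k u : nform_span u -> nform_span (k *: u).
Proof.
move=> Su; rewrite -[_ *: u]addr0; apply: nform_spanP => //.
by rewrite -(linear0 phi); apply: nform_span_phi.
Qed.

Lemma nform_span_phi1M k u : nform_span u -> nform_span (z ^+ k * u).
Proof.
move=> [c [x0 [x1 [x2 [x3 ->]]]]].
elim: k c x0 x1 x2 x3 => [|k IHk] c x0 x1 x2 x3.
  by rewrite mul1r; do 5!eexists.
by rewrite exprSr -mulrA phi1_nform; apply: IHk.
Qed.

Lemma nform_span_phiM a u : nform_span u -> nform_span (phi a * u).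
Proof.
have S_phi_phi k x : nform_span (phi a * (z ^+ k * phi x)).
  rewrite mulrA phi1X_comm -mulrA phi_mul; apply/nform_span_phi1M/nform_spanZ.
  rewrite -linearD -linearB.
  apply: nform_spanD; last exact/nform_span_phi1M/nform_span_phi.
  by rewrite -[z]expr1; apply/nform_span_phi1M/nform_span_phi.
move=> [c [x0 [x1 [x2 [x3 ->]]]]]; rewrite /nform !mulrDr.
do 4?apply: nform_spanD.
- by rewrite mulr_algr; apply/nform_spanZ/nform_span_phi.
- by rewrite -[phi x0]mul1r; apply: (S_phi_phi 0%N).
- exact: (S_phi_phi 1%N).
- exact: S_phi_phi.
- exact: S_phi_phi.
Qed.

Section Independence.

(* The triple identity alone does not bound A from below; enough representations
   of A on F^n do. *)
Hypothesis rep_ext : forall mu : 'M[F]_n -> 'M[F]_n, linear mu ->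
  (forall a b c,
    mu a * mu b * mu c - mu c * mu b * mu a = mu (a * b * c - c * b * a)) ->
  exists g : A -> 'M[F]_n,
    [/\ linear g, {morph g : u v / u * v}, g 1 = 1 & forall x, g (phi x) = mu x].

Lemma nform_rep (mu : 'M[F]_n -> 'M[F]_n) s c x0 x1 x2 x3 : linear mu ->
  (forall a b c,
    mu a * mu b * mu c - mu c * mu b * mu a = mu (a * b * c - c * b * a)) ->
  mu 1 = s%:M -> nform c x0 x1 x2 x3 = 0 ->
  c%:M + mu x0 + s *: mu x1 + s ^+ 2 *: mu x2 + s ^+ 3 *: mu x3 = 0.
Proof.
move=> mu_lin mu_triple mu1 u0.
have [g [/linear_bundle[g' g'E] gM g1 gphi]] := rep_ext mu_lin mu_triple.
have gz k x : g (z ^+ k * phi x) = s ^+ k *: mu x.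
  elim: k => [|k IHk]; first by rewrite mul1r scale1r gphi.
  by rewrite exprS -mulrA gM IHk gphi mu1 -mulmxE mul_scalar_mx scalerA exprS.
have := congr1 g' u0; rewrite linear0 => <-.
rewrite /nform !linearD linearZ_LR !g'E g1 gphi !gz.
by rewrite -[g (z * _)]/(g (z ^+ 1 * _)) gz expr1 -scalemx1.
Qed.

(** The representation 0 detects c.  The values s = 1, -1 on x and s = l, - l on
    x^T form, in each entry, a Vandermonde system in the four fourth roots of
    unity. *)
Lemma nform_free (l : F) c x0 x1 x2 x3 : l ^+ 2 = -1 ->
  nform c x0 x1 x2 x3 = 0 -> [/\ c = 0, x0 = 0, x1 = 0, x2 = 0 & x3 = 0].
Proof.
move=> l2 u0.
have l0 : l != 0.
  by apply: contra_eq_neq l2 => ->; rewrite expr0n eq_sym oppr_eq0 oner_neq0.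
have rep s : s ^+ 3 = s -> c%:M + s *: x0 + s *: (s *: x1)
    + s ^+ 2 *: (s *: x2) + s ^+ 3 *: (s *: x3) = 0.
  move=> s3.
  apply: (nform_rep (mu := fun x => s *: x) _ _ _ u0) => [k x y|a b d|].
  - by rewrite scalerDr !scalerA mulrC.
  - exact: scale_triple.
  - exact: scalemx1.
have rep_tr s : s ^+ 3 = - s -> c%:M + s *: x0^T + s *: (s *: x1^T)
    + s ^+ 2 *: (s *: x2^T) + s ^+ 3 *: (s *: x3^T) = 0.
  move=> s3.
  apply: (nform_rep (mu := fun x => s *: x^T) _ _ _ u0) => [k x y|a b d|].
  - by rewrite linearD linearZ /= scalerDr !scalerA mulrC.
  - exact: scale_tr_triple.
  - by rewrite trmx1 scalemx1.
have c0 : c = 0.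
  have := rep 0 (expr0n _ 3); rewrite !(scale0r, scaler0) !addr0.
  exact: scalar_mx_eq0.
suff x_eq0 i j : [/\ x0 i j = 0, x1 i j = 0, x2 i j = 0 & x3 i j = 0].
  by split=> //; apply/matrixP => i j; have [] := x_eq0 i j; rewrite !mxE.
have l3 : l ^+ 3 = - l by rewrite exprS l2 mulrN1.
have l3N : (- l) ^+ 3 = - - l by rewrite exprS sqrrN l2 mulrN1.
have /matrixP/(_ i j) e1 := rep 1 (expr1n _ _).
have /matrixP/(_ i j) e2 := rep (-1) (esym (signr_odd _ 3)).
have /matrixP/(_ j i) e3 := rep_tr l l3.
have /matrixP/(_ j i) e4 := rep_tr (- l) l3N.
rewrite c0 !mxE !mul0rn ?l3 ?l3N ?sqrrN ?l2 in e1 e2 e3 e4.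
move: (x0 i j) (x1 i j) (x2 i j) (x3 i j) e1 e2 e3 e4 => p q r t e1 e2 e3 e4.
have l2' : l * l + 1 = 0 by rewrite -expr2 l2 addNr.
have {}e1 : p + q + r + t = 0 by rewrite -e1; ring.
have {}e2 : - p + q - r + t = 0 by rewrite -e2; ring.
have {}e3 : l * p - q - l * r + t = 0.
  by rewrite -[RHS](mul0r (t - q)) -l2' -[LHS]subr0 -[X in _ - X]e3; ring.
have {}e4 : - l * p - q + l * r + t = 0.
  by rewrite -[RHS](mul0r (t - q)) -l2' -[LHS]subr0 -[X in _ - X]e4; ring.
have F4 : (4 : F) != 0 by exact: (@natF_neq0 4%N _).
split; apply: (mulfI F4); rewrite mulr0.
- apply: (mulfI l0); rewrite mulr0.
  transitivity (l * ((p + q + r + t) - (- p + q - r + t)) +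
    ((l * p - q - l * r + t) - (- l * p - q + l * r + t))); first by ring.
  by rewrite e1 e2 e3 e4 !(subrr, mulr0, addr0).
- transitivity ((p + q + r + t) + (- p + q - r + t) -
    ((l * p - q - l * r + t) + (- l * p - q + l * r + t))); first by ring.
  by rewrite e1 e2 e3 e4 !(subrr, addr0).
- apply: (mulfI l0); rewrite mulr0.
  transitivity (l * ((p + q + r + t) - (- p + q - r + t)) -
    ((l * p - q - l * r + t) - (- l * p - q + l * r + t))); first by ring.
  by rewrite e1 e2 e3 e4 !(subrr, mulr0, addr0).
- transitivity ((p + q + r + t) + (- p + q - r + t) +
    ((l * p - q - l * r + t) + (- l * p - q + l * r + t))); first by ring.
  by rewrite e1 e2 e3 e4 !addr0.
Qed.

End Independence.

(** * The center *)

Definition phi1_pol c0 c1 c2 c3 c4 : A :=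
  c0%:A + c1 *: z + c2 *: z ^+ 2 + c3 *: z ^+ 3 + c4 *: z ^+ 4.

Lemma phi1_polE c0 c1 c2 c3 c4 :
  phi1_pol c0 c1 c2 c3 c4 = nform c0 c1%:M c2%:M c3%:M c4%:M.
Proof.
rewrite /nform -[c1%:M]scalemx1 -[c2%:M]scalemx1 -[c3%:M]scalemx1.
by rewrite -[c4%:M]scalemx1 !linearZ /= -!scalerAr -expr2 -!exprSr.
Qed.

Lemma phi1_pol_linear k c0 c1 c2 c3 c4 d0 d1 d2 d3 d4 :
  k *: phi1_pol c0 c1 c2 c3 c4 + phi1_pol d0 d1 d2 d3 d4 =
  phi1_pol (k * c0 + d0) (k * c1 + d1) (k * c2 + d2) (k * c3 + d3) (k * c4 + d4).
Proof.
rewrite /phi1_pol !scalerDl -!scalerA !scalerDr.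
by do 4![rewrite addrACA; congr (_ + _)].
Qed.

Section Center.

Hypothesis A_span : forall u, nform_span u.
Hypothesis nform_inj : forall c x0 x1 x2 x3,
  nform c x0 x1 x2 x3 = 0 -> [/\ c = 0, x0 = 0, x1 = 0, x2 = 0 & x3 = 0].

Lemma phi1_pol_inj c0 c1 c2 c3 c4 :
  phi1_pol c0 c1 c2 c3 c4 = 0 -> [/\ c0 = 0, c1 = 0, c2 = 0, c3 = 0 & c4 = 0].
Proof.
rewrite phi1_polE => /nform_inj[-> h1 h2 h3 h4].
by split=> //; exact: (scalar_mx_eq0 n_gt0).
Qed.

Lemma phi1_pol_central c0 c1 c2 c3 c4 : @ring_center A (phi1_pol c0 c1 c2 c3 c4).
Proof.
move=> v; have zC : GRing.comm v z.
  have [c [x0 [x1 [x2 [x3 ->]]]]] := A_span v.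
  have zkC k x : GRing.comm z (z ^+ k * phi x).
    by apply: commrM; [apply/commrX | apply/esym/phi1_comm].
  apply: commr_sym; do 4?apply: commrD; try exact: (zkC 1%N); try exact: zkC.
    by rewrite /GRing.comm mulr_algl mulr_algr.
  exact/esym/phi1_comm.
have zkC k : z ^+ k * v = v * z ^+ k by apply/esym/commrX.
rewrite /phi1_pol !mulrDr !mulrDl -!scalerAl -!scalerAr mul1r mulr1.
by rewrite !zkC zC.
Qed.

(** Commuting with phi(a) multiplies by z^3 and replaces each coefficient x by
    xa - ax; since z^4 = 1 on phi, the normal form of the commutator of u with
    phi(a) has the coefficients [x_1, a], [x_2, a], [x_3, a], [x_0, a]. *)
Lemma center_phi1_pol u : @ring_center A u ->
  exists c0 c1 c2 c3 c4, u = phi1_pol c0 c1 c2 c3 c4.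
Proof.
move=> u_comm; have [c [x0 [x1 [x2 [x3 u_def]]]]] := A_span u.
have com k x a : z ^+ k * phi x * phi a - phi a * (z ^+ k * phi x) =
    z ^+ (k + 3) * phi (x * a - a * x).
  rewrite (mulrA (phi a)) phi1X_comm -!mulrA -mulrBr exprD -mulrA.
  by rewrite linearB phi_commutator_pow3.
have x_comm a : [/\ (0 : F) = 0, x1 * a - a * x1 = 0, x2 * a - a * x2 = 0,
    x3 * a - a * x3 = 0 & x0 * a - a * x0 = 0].
  apply: nform_inj; rewrite /nform scale0r add0r.
  have com0 : _ = z ^+ 3 * _ := com 0%N x0 a.
  have com1 : _ = z ^+ 4 * _ := com 1%N x1 a.
  have com2 : _ = z ^+ 5 * _ := com 2%N x2 a.
  have com3 : _ = z ^+ 6 * _ := com 3%N x3 a.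
  rewrite phi_pow4 in com1.
  rewrite (exprS z 4%N) -(mulrA z (z ^+ 4)) phi_pow4 in com2.
  rewrite (exprD z 2%N 4%N) -(mulrA _ (z ^+ 4)) phi_pow4 in com3.
  rewrite -com0 -com1 -com2 -com3.
  have := u_comm (phi a); rewrite u_def /nform => /eqP.
  rewrite -subr_eq0 => /eqP <-.
  rewrite mulrDl !mulrDl !mulrDr mulr_algl mulr_algr expr0 expr1 !mul1r.
  by move: (c *: _) => d; ncring.
have scal (x : 'M[F]_n) : (forall a, x * a - a * x = 0) -> exists c, x = c%:M.
  by move=> xC; apply: scalar_mx_of_comm => // a; apply/subr0_eq/xC.
have [|c1 x0E] := scal x0; first by move=> a; have [] := x_comm a.
have [|c2 x1E] := scal x1; first by move=> a; have [] := x_comm a.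
have [|c3 x2E] := scal x2; first by move=> a; have [] := x_comm a.
have [|c4 x3E] := scal x3; first by move=> a; have [] := x_comm a.
by exists c, c1, c2, c3, c4; rewrite phi1_polE u_def x0E x1E x2E x3E.
Qed.

(** With respect to z^4, z^2, z^3, z, 1, in this order, the family is triangular
    with diagonal 1/n, 1, 1/2, 1, 1. *)
Lemma phi1_pol_basis :
  is_basis [tuple phi1_pol 0 0 (- n%:R^-1) 0 n%:R^-1; phi1_pol 0 0 1 0 0;
                  phi1_pol 0 (- 2^-1) 0 2^-1 0; phi1_pol 0 1 0 0 0;
                  phi1_pol 1 0 0 0 0] (@ring_center A).
Proof.
have Fn := natF_neq0 n_gt0.
have combE b1 b2 b3 b4 b5 :
    b1 *: phi1_pol 0 0 (- n%:R^-1) 0 n%:R^-1 + b2 *: phi1_pol 0 0 1 0 0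
    + b3 *: phi1_pol 0 (- 2^-1) 0 2^-1 0 + b4 *: phi1_pol 0 1 0 0 0
    + b5 *: phi1_pol 1 0 0 0 0 =
    phi1_pol b5 (b4 - b3 / 2) (b2 - b1 / n%:R) (b3 / 2) (b1 / n%:R).
  have pol0 : phi1_pol 0 0 0 0 0 = 0 by rewrite /phi1_pol !scale0r !addr0.
  rewrite -!addrA -[_ *: phi1_pol 1 0 0 0 0]addr0 -pol0 !phi1_pol_linear.
  by congr phi1_pol; ring.
apply: is_basis5; first by split; apply: phi1_pol_central.
  move=> b1 b2 b3 b4 b5; rewrite combE => /phi1_pol_inj[b5_0 b4_ b2_ b3_ b1_].
  have b1_0 : b1 = 0 by rewrite -[b1](divfK Fn) b1_ mul0r.
  have b3_0 : b3 = 0 by rewrite -[b3](divfK F2) b3_ mul0r.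
  by rewrite b1_ subr0 in b2_; rewrite b3_ subr0 in b4_.
move=> u /center_phi1_pol[c0 [c1 [c2 [c3 [c4 ->]]]]].
exists (c4 * n%:R), (c2 + c4), (c3 * 2), (c1 + c3), c0.
by rewrite combE !mulfK // !addrK.
Qed.

End Center.

(** * The distinguished central elements as polynomials in z *)

Section CentralElements.

Variable e : 'I_n -> 'I_n -> A.
Hypothesis phi_delta : forall i j, phi (delta_mx i j) = e i j.

Let o : 'I_n := Ordinal (ltnW n_ge2).

Lemma gen_mul_opp i j : i != j ->
  e i j * e j i = 2^-1 *: (z * (e i i + e j j) + z ^+ 3 * (e i i - e j j)).
Proof.
by move=> ne_ij; rewrite -!phi_delta phi_mul -!mulmxE !mul_delta_mx.
Qed.

Lemma gen_diag_exp i k : e i i ^+ k.+1 = z ^+ k * e i i.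
Proof.
rewrite -phi_delta; set x := delta_mx i i.
have phi_xx : phi x * phi x = z * phi x.
  rewrite phi_mul -!mulmxE !mul_delta_mx subrr mulr0 addr0 -mulr2n -scaler_nat.
  by rewrite -scalerAr scalerK.
elim: k => [|k IHk]; first by rewrite mul1r.
by rewrite exprS IHk mulrA phi1X_comm -mulrA phi_xx mulrA exprSr.
Qed.

Lemma sum_gen_diag : \sum_(i < n) e i i = z.
Proof.
rewrite -[1]/(1%:M) scalar_mx_sum_delta linear_sum; apply: eq_bigr => i _.
by rewrite scale1r phi_delta.
Qed.

Lemma sum_gen_diag_pos : \sum_(i < n | (0 < i)%N) e i i = z - e o o.
Proof.
rewrite -sum_gen_diag [X in _ = X - _](bigD1 o) //= [X in _ = X]addrC addKr.
by apply: eq_bigl => i; rewrite -val_eqE /= lt0n.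
Qed.

Let card_pos_ord : #|[pred i : 'I_n | (0 < i)%N]| = n.-1.
Proof.
rewrite -[n in RHS]card_ord -(cardC1 o); apply: eq_card => i.
by rewrite !inE -val_eqE /= lt0n.
Qed.

(* The powers of e_oo and the sums over i of e_oi e_io and of e_io e_oi lie in
   the span of these four elements, which turns the computation of z_1 and z_2
   into identities between coefficients. *)
Let comb a b c d : A :=
  a *: (z * e o o) + b *: (z ^+ 3 * e o o) + c *: z ^+ 2 + d *: z ^+ 4.

Let comb_linear k a b c d a' b' c' d' :
  k *: comb a b c d + comb a' b' c' d' =
  comb (k * a + a') (k * b + b') (k * c + c') (k * d + d').
Proof.
rewrite /comb !scalerDl -!scalerA !scalerDr.
by do 3![rewrite addrACA; congr (_ + _)].
Qed.

Let nu : F := n.-1%:R.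

Let n_nu : n%:R = nu + 1. Proof. by rewrite natr1 prednK. Qed.

Lemma sum_out_in : \sum_(i < n | (0 < i)%N) e o i * e i o =
  comb (2^-1 * (nu - 1)) (2^-1 * (nu + 1)) 2^-1 (- 2^-1).
Proof.
under eq_bigr => i i_gt0.
  rewrite gen_mul_opp; last by rewrite -val_eqE /= eq_sym -lt0n.
  over.
rewrite -scaler_sumr big_split -!mulr_sumr sumrB big_split /=.
rewrite sumr_const card_pos_ord sum_gen_diag_pos.
rewrite -scaler_nat -/nu /comb -[- 2^-1]mulrN1 -!scalerA -!scalerDr.
rewrite !mulrBr !mulrDr -!scalerAr scalerBl scalerDl !scale1r scaleN1r.
rewrite (exprSr z 3%N) -expr2.
congr (_ *: _); move: (nu *: (z * _)) (nu *: (z ^+ 3 * _)) => u v.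
by ncring.
Qed.

Lemma sum_in_out : \sum_(i < n | (0 < i)%N) e i o * e o i =
  comb (2^-1 * (nu - 1)) (- (2^-1 * (nu + 1))) 2^-1 2^-1.
Proof.
under eq_bigr => i i_gt0.
  rewrite gen_mul_opp; last by rewrite -val_eqE /= -lt0n.
  over.
rewrite -scaler_sumr big_split -!mulr_sumr sumrB big_split /=.
rewrite sumr_const card_pos_ord sum_gen_diag_pos.
rewrite -scaler_nat -/nu /comb -mulrN -!scalerA -!scalerDr.
rewrite !mulrBr !mulrDr -!scalerAr scaleNr scalerBl scalerDl !scale1r.
rewrite (exprSr z 3%N) -expr2.
congr (_ *: _); move: (nu *: (z * _)) (nu *: (z ^+ 3 * _)) => u v.
by ncring.
Qed.

Let phi1_pol_comb c d : phi1_pol 0 0 c 0 d = comb 0 0 c d.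
Proof. by rewrite /phi1_pol /comb !scale0r !addr0 !add0r. Qed.

Let gen_sqr_comb : e o o ^+ 2 = comb 1 0 0 0.
Proof. by rewrite gen_diag_exp /comb !scale0r scale1r !addr0. Qed.

Lemma z1_phi1_pol :
  ((n%:R - 2) / n%:R) *: e o o ^+ 2
  - (2 / n%:R) *: (\sum_(i < n | (0 < i)%N) e o i * e i o)
  + e o o ^+ 4 = phi1_pol 0 0 (- n%:R^-1) 0 n%:R^-1.
Proof.
have gen_four : e o o ^+ 4 = comb 0 1 0 0.
  by rewrite gen_diag_exp /comb !scale0r scale1r !addr0 add0r.
have Fn := natF_neq0 n_gt0; rewrite n_nu in Fn *.
rewrite phi1_pol_comb gen_sqr_comb gen_four sum_out_in -scaleNr -addrA.
by rewrite !comb_linear; congr comb; field; rewrite ?F2 ?Fn.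
Qed.

Lemma z2_phi1_pol :
  (2 - n%:R) *: e o o ^+ 2 + \sum_(i < n | (0 < i)%N) e o i * e i o
  + \sum_(i < n | (0 < i)%N) e i o * e o i = phi1_pol 0 0 1 0 0.
Proof.
rewrite phi1_pol_comb gen_sqr_comb sum_out_in sum_in_out n_nu comb_linear.
rewrite -[X in X + _]scale1r comb_linear.
by congr comb; field; rewrite ?F2.
Qed.

Lemma z3_phi1_pol :
  - (2^-1 *: e o o) + 2^-1 *: e o o ^+ 3
  + \sum_(i < n | (0 < i)%N) e o i * e o o * e i o =
  phi1_pol 0 (- 2^-1) 0 2^-1 0.
Proof.
have term (i : 'I_n) : (0 < i)%N ->
    e o i * e o o * e i o = 2^-1 *: (z ^+ 2 * e i i - e i i).
  move=> i_gt0; have ne_io : i != o by rewrite -val_eqE /= -lt0n.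
  have -> : e o i * e o o = 2^-1 *: ((z - z ^+ 3) * e o i).
    rewrite -!phi_delta phi_mul -!mulmxE mul_delta_mx_0 // mul_delta_mx linear0.
    by rewrite add0r sub0r mulrN -mulrBl.
  rewrite -scalerAl -mulrA gen_mul_opp 1?eq_sym // -scalerAr.
  congr (_ *: _); apply: (scalerI F2); rewrite scalerA mulfV // scale1r.
  have -> : (z - z ^+ 3) * (z * (e o o + e i i) + z ^+ 3 * (e o o - e i i)) =
      z ^+ 2 * (e o o + e i i) + (z ^+ 4 * e o o - z ^+ 4 * e i i)
      - (z ^+ 4 * e o o + z ^+ 4 * e i i)
      - z ^+ 2 * (z ^+ 4 * e o o - z ^+ 4 * e i i).
    by rewrite !exprS expr0 !mulr1; ncring.
  by rewrite -!phi_delta !phi_pow4 scaler_nat mulr2n; ncring.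
rewrite (eq_bigr _ term) -scaler_sumr sumrB -mulr_sumr sum_gen_diag_pos gen_diag_exp.
rewrite /phi1_pol !scale0r add0r addr0 addr0 scaleNr -!scalerN -!scalerDr.
by congr (_ *: _); rewrite (exprSr z 2%N); ncring.
Qed.

Lemma z4_phi1_pol : \sum_(i < n) e i i = phi1_pol 0 1 0 0 0.
Proof. by rewrite sum_gen_diag /phi1_pol !scale0r !addr0 add0r scale1r. Qed.

Lemma z5_phi1_pol : 1 = phi1_pol 1 0 0 0 0.
Proof. by rewrite /phi1_pol !scale0r !addr0 scale1r. Qed.

End CentralElements.

End TripleRepresentation.

(** * The universal property of the envelope *)

Section Envelope.

Variables (F : fieldType) (n : nat).

(** Every element is a linear combination of words, and a word is obtained from
    1 by multiplying by generators on the left. *)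
Lemma env_ind (P : envelope F n -> Prop) :
  P 1 -> (forall u v, P u -> P v -> P (u + v)) ->
  (forall c u, P u -> P (c *: u)) ->
  (forall i j u, P u -> P (env_gen i j * u)) -> forall u, P u.
Proof.
move=> P1 PD PZ Pe u; rewrite -[u]env_reprK.
have P0 : P 0 by rewrite -(scale0r 1); apply: PZ.
rewrite [repr u]monalgE.
rewrite (big_morph _ (@env_piD F n) (raddf0 \pi_(envelope F n)%qT)).
elim/big_ind: _ => // k _.
have -> : << (repr u)@_k *g k >> = (repr u)@_k *: (<< k >> : free_alg F n).
  by apply/malgP=> v; rewrite mcoeffZ !mcoeffU mulrnAr mulr1.
rewrite -env_pi_scale; apply: PZ.
case: k => w; elim: w => [|[i j] w IHw].
  by rewrite -fmoneE.
have -> : (<< FMonom ((i, j) :: w) >> : free_alg F n) =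
    gen F i j * << FMonom w >>.
  rewrite /gen malgM_def fgmulUU mulr1; congr << _ >>.
  by apply/val_inj; rewrite /= fmM fmU.
by rewrite -env_pi_mul; apply: Pe.
Qed.

Lemma env_gen_rel (i j k l m t : 'I_n) :
  (env_gen i j * env_gen k l * env_gen m t - env_gen m t * env_gen k l * env_gen i j
  - ((j == k)%:R * (l == m)%:R) *: env_gen i t
  + ((t == k)%:R * (l == i)%:R) *: env_gen m j : envelope F n) = 0.
Proof.
have piN x : env_pi (- x) = - env_pi x :> envelope F n.
  exact: (raddfN \pi_(envelope F n)%qT).
have piM x y : env_pi (x * y) = env_pi x * env_pi y :> envelope F n.
  exact/esym/env_pi_mul.
have piZ s x : env_pi (s *: x) = s *: env_pi x :> envelope F n.
  exact/esym/env_pi_scale.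
have pi_word x y w :
    env_pi (x * y * w) = env_pi x * env_pi y * env_pi w :> envelope F n.
  by rewrite (piM (x * y)) (piM x).
have pi_sum p q r s (p' q' r' s' : envelope F n) :
    env_pi p = p' -> env_pi q = q' -> env_pi r = r' -> env_pi s = s' ->
    env_pi (p - q - r + s) = p' - q' - r' + s'.
  by move=> <- <- <- <-; rewrite !env_piD !piN.
have pi_rel x y w u v r s : env_pi (x * y * w - w * y * x - r *: u + s *: v) =
    env_pi x * env_pi y * env_pi w - env_pi w * env_pi y * env_pi x
    - r *: env_pi u + s *: env_pi v :> envelope F n.
  exact (pi_sum _ _ _ _ _ _ _ _
    (pi_word x y w) (pi_word w y x) (piZ r u) (piZ s v)).
apply: etrans (esym (pi_rel _ _ _ _ _ _ _)) _.
apply: etrans (_ : env_pi 0 = 0); last exact: (raddf0 \pi_(envelope F n)%qT).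
apply/env_pi_eq; rewrite subr0.
by apply: ideal_gen_mem; exists i, j, k, l, m, t.
Qed.

Section Lift.

Variables (B : algType F) (b : 'I_n -> 'I_n -> B).
Hypothesis b_rel : forall i j k l m t : 'I_n,
  b i j * b k l * b m t - b m t * b k l * b i j
  - ((j == k)%:R * (l == m)%:R) *: b i t
  + ((t == k)%:R * (l == i)%:R) *: b m j = 0.

Definition word_val (w : {fmonom ('I_n * 'I_n)%type}) : B :=
  \prod_(ij <- (w : seq _)) b ij.1 ij.2.

Lemma word_val_mmorphism : mmorphism word_val.
Proof.
split=> [v w|]; first by rewrite /word_val fmM big_cat.
by rewrite /word_val fm1 big_nil.
Qed.

HB.instance Definition _ :=
  isMultiplicative.Build _ _ word_val word_val_mmorphism.

Definition free_lift : free_alg F n -> B := mmap (in_alg B) word_val.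

Lemma free_liftM x y : free_lift (x * y) = free_lift x * free_lift y.
Proof.
apply: (commr_mmap_is_multiplicative _).1 => c v w.
by rewrite /GRing.comm /= mulr_algl mulr_algr.
Qed.

Lemma free_lift_gen i j : free_lift (gen F i j) = b i j.
Proof.
by rewrite /free_lift /gen mmapU /= scale1r mul1r /word_val fmU big_seq1.
Qed.

Lemma free_lift_linear : linear free_lift.
Proof.
move=> c x y; rewrite /free_lift mmapD.
by rewrite -[in RHS]mulr_algl; congr (_ + _); apply: mmapZ.
Qed.

Lemma free_lift_ideal x : ideal_gen (@is_relator F n) x -> free_lift x = 0.
Proof.
have flD u v : free_lift (u + v) = free_lift u + free_lift v by exact: mmapD.
have flN u : free_lift (- u) = - free_lift u by exact: mmapN.
have flZ c u : free_lift (c *: u) = c *: free_lift u.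
  by rewrite -[RHS]mulr_algl; apply: mmapZ.
elim=> [_ [i [j [k [l [m [t ->]]]]]]||u v _ IHu _ IHv|u v w _ IHv].
- by rewrite /relator !(flD, flN, flZ, free_liftM, free_lift_gen) b_rel.
- exact: mmap0.
- by rewrite flD IHu IHv addr0.
- by rewrite !free_liftM IHv mulr0 mul0r.
Qed.

Lemma env_lift : exists g : envelope F n -> B,
  [/\ linear g, {morph g : u v / u * v}, g 1 = 1 &
      forall i j, g (env_gen i j) = b i j].
Proof.
pose g (u : envelope F n) := free_lift (repr u).
have gE x : g (env_pi x) = free_lift x.
  apply/eqP; rewrite -subr_eq0 -scaleN1r addrC -free_lift_linear scaleN1r addrC.
  by apply/eqP/free_lift_ideal/env_pi_eq; rewrite env_reprK.
exists g; split.
- move=> c u v; rewrite -[u]env_reprK -[v]env_reprK !gE.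
  rewrite -[c *: _]/(env_scale c _) env_pi_scale -env_piD gE.
  exact: free_lift_linear.
- move=> u v; rewrite -[u]env_reprK -[v]env_reprK.
  by rewrite -[_ * _]/(env_mul _ _) env_pi_mul !gE free_liftM.
- by rewrite -[1]/(env_pi 1) gE /free_lift mmap1.
- by move=> i j; rewrite gE free_lift_gen.
Qed.

End Lift.

End Envelope.

Lemma env_rep (F : fieldType) (n : nat) (mu : 'M[F]_n -> 'M[F]_n) :
  (0 < n)%N -> linear mu ->
  (forall a b c,
    mu a * mu b * mu c - mu c * mu b * mu a = mu (a * b * c - c * b * a)) ->
  exists g : envelope F n -> 'M[F]_n,
    [/\ linear g, {morph g : u v / u * v}, g 1 = 1 &
        forall x, g (mx_comb (@env_gen F n) x) = mu x].
Proof.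
case: n mu => [|m] mu // _ mu_lin mu_triple.
have [mu' mu'E] := linear_bundle mu_lin.
have [i j k l p t|g [g_lin gM g1 ge]] :=
    @env_lift F m.+1 'M[F]_m.+1 (fun i j => mu (delta_mx i j)).
  rewrite mu_triple -[mu _]mu'E.
  rewrite -[mu' _](congr1 mu' (esym (triple_delta F i j k l p t))).
  by rewrite linearB !(linearZ_LR mu') !mu'E addrAC subrK subrr.
exists g; split=> //.
apply: linear_delta_ext => // [r x y|i j]; last by rewrite mx_comb_delta ge.
by rewrite linearP g_lin.
Qed.

Theorem theorem5p1 (F : closedFieldType) (n : nat)
    (charF0 : [pchar F] =i pred0) (n_ge2 : (2 <= n)%N) :
  has_dimension (@ring_center (envelope F n)) 5 /\
  is_basis [tuple center_z1 F n_ge2; center_z2 F n_ge2; center_z3 F n_ge2;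
                  center_z4 F n; center_z5 F n]
           (@ring_center (envelope F n)).
Proof.
set e := @env_gen F n; pose phi : {linear 'M[F]_n -> envelope F n} := mx_comb e.
have triple := mx_comb_triple (@env_gen_rel F n) : forall a b c,
  phi a * phi b * phi c - phi c * phi b * phi a = phi (a * b * c - c * b * a).
have phi_delta i j : phi (delta_mx i j) = e i j by apply: mx_comb_delta.
have span u : nform_span phi u.
  elim/env_ind: u => [|u v|c u|i j u].
  - exact: nform_span1.
  - exact: nform_spanD.
  - exact: nform_spanZ.
  - by rewrite -[env_gen i j]phi_delta; apply: nform_span_phiM.
have [l l2] := imaginary_exists F.
have inj c x0 x1 x2 x3 := nform_free charF0 n_ge2
  (fun mu => @env_rep F n mu (ltnW n_ge2)) l2 (c := c) (x0 := x0) (x1 := x1)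
  (x2 := x2) (x3 := x3).
have basis : is_basis [tuple center_z1 F n_ge2; center_z2 F n_ge2;
    center_z3 F n_ge2; center_z4 F n; center_z5 F n] (@ring_center (envelope F n)).
  have := phi1_pol_basis charF0 n_ge2 triple span inj.
  rewrite -(z1_phi1_pol charF0 n_ge2 triple phi_delta).
  rewrite -(z2_phi1_pol charF0 n_ge2 triple phi_delta).
  rewrite -(z3_phi1_pol charF0 n_ge2 triple phi_delta).
  rewrite -(z4_phi1_pol phi_delta) -(z5_phi1_pol phi).
  exact.
by split; [exists [tuple center_z1 F n_ge2; center_z2 F n_ge2; center_z3 F n_ge2;
                         center_z4 F n; center_z5 F n] | ].
Qed.
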